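(* Let $G=(V,E)$ be a finite weighted graph with edge weights $\mu$, and let $\Omega\subset V$ be such that the graph $\widetilde{\Omega}$ is connected. Then $$h_E(\widetilde{\Omega})=\inf_{f}\frac{\sum_{e=\{x,y\}\in E(\Omega,\overline{\Omega})}\mu_{xy}|f(x)-f(y)|}{\inf_{a\in\mathbb{R}}\sum_{x\in\delta\Omega}m_x|f(x)-a|},$$ where the outer infimum is over all functions $f:\overline{\Omega}\to\mathbb{R}$ for which the denominator is nonzero (i.e. $f$ is not constant on $\delta\Omega$).
   Context: $V$ is a finite set and $\mu:V\times V\to[0,\infty)$, $(x,y)\mapsto\mu_{xy}=\mu_{yx}$, is a symmetric weight function; $\{x,y\}\in E$ (written $x\sim y$) iff $\mu_{xy}>0$. Self-loops are allowed. For $\Omega_1,\Omega_2\subset V$, $E(\Omega_1,\Omega_2)=\{\{x,y\}\in E: x\in\Omega_1,y\in\Omega_2\}$ (unordered edges, each counted once in sums). For $F\subset E$, $\mu(F)=\sum_{\{x,y\}\in F}\mu_{xy}$. The vertex boundary of $\Omega$ is $\delta\Omega=\{x\in V\setminus\Omega: x\sim y\text{ for some }y\in\Omega\}$, and $\overline{\Omega}=\Omega\cup\delta\Omega$. The graph $\widetilde{\Omega}$ has vertex set $\overline{\Omega}$ and edge set $E(\Omega,\overline{\Omega})$ (edges between two vertices of $\delta\Omega$ are discarded). The measure $m:\overline{\Omega}\to(0,\infty)$ is $m_x=\sum_{y\in V,\,y\sim x}\mu_{xy}$ for $x\in\Omega$ and $m_x=\sum_{y\in\Omega,\,y\sim x}\mu_{xy}$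 for $x\in\delta\Omega$ (assumed positive everywhere); $m(A)=\sum_{x\in A}m_x$ for $A\subset\overline{\Omega}$. For $A\subset\overline{\Omega}$, $\partial_\Omega A=E(A,V\setminus A)\cap E(\Omega,\overline{\Omega})$. The Escobar-type Cheeger constant is $$h_E(\widetilde{\Omega})=\inf\left\{\frac{\mu(\partial_\Omega A)}{m(A\cap\delta\Omega)}: A\subset\overline{\Omega},\ 0<m(A\cap\delta\Omega)\le\tfrac12 m(\delta\Omega)\right\}.$$ The convention $\inf\emptyset=+\infty$ is used. *)

(* Defs.v *)
From HB Require Import structures.
From mathcomp Require Import all_boot all_order all_algebra.
From mathcomp Require Import all_classical all_reals ereal.
Set Implicit Arguments.
Unset Strict Implicit.
Unset Printing Implicit Defensive.
Import Order.TTheory GRing.Theory Num.Theory.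
Local Open Scope ring_scope.

(* Unordered edges are sets [set x; y] of vertices; a loop at x is [set x; x],
   that is, the singleton of x. *)

Definition edges (R : realType) (V : finType) (mu : V -> V -> R)
    (A B : {set V}) : {set {set V}} :=
  [set [set x; y]%SET | x in A, y in B & 0 < mu x y]%SET.

(* The value of F x y on the unordered edge e = {x, y}. The choice of
   the ordered pair is immaterial when F is symmetric, see edge_valE. *)
Definition edge_val (R : realType) (V : finType) (F : V -> V -> R)
    (e : {set V}) : R :=
  if [pick p : V * V | e == [set p.1; p.2]%SET] is Some p
  then F p.1 p.2 else 0.

Lemma edge_valE (R : realType) (V : finType) (F : V -> V -> R) (x y : V) :
  (forall u v, F u v = F v u) -> edge_val F [set x; y]%SET = F x y.
Proof.
move=> symF; rewrite /edge_val; case: pickP => [[u v] /= /eqP exy|/(_ (x, y))].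
  have ux : u \in [set x; y]%SET by rewrite exy !inE eqxx.
  have vx : v \in [set x; y]%SET by rewrite exy !inE eqxx orbT.
  have xu : x \in [set u; v]%SET by rewrite -exy !inE eqxx.
  have yu : y \in [set u; v]%SET by rewrite -exy !inE eqxx orbT.
  move: ux vx xu yu; rewrite !inE.
  by have := symF x y; move=> ? /orP[]/eqP ? /orP[]/eqP ? /orP[]/eqP ? /orP[]/eqP ?;
    congruence.
by rewrite eqxx.
Qed.

Definition edge_weight (R : realType) (V : finType) (mu : V -> V -> R)
    (F : {set {set V}}) : R :=
  \sum_(e in F) edge_val mu e.

Definition vbdry (R : realType) (V : finType) (mu : V -> V -> R)
    (Omega : {set V}) : {set V} :=
  [set x in ~: Omega | [exists y in Omega, 0 < mu x y]]%SET.

Definition vclosure (R : realType) (V : finType) (mu : V -> V -> R)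
    (Omega : {set V}) : {set V} :=
  (Omega :|: vbdry mu Omega)%SET.

Definition tilde_edges (R : realType) (V : finType) (mu : V -> V -> R)
    (Omega : {set V}) : {set {set V}} :=
  edges mu Omega (vclosure mu Omega).

Definition tilde_connected (R : realType) (V : finType) (mu : V -> V -> R)
    (Omega : {set V}) : Prop :=
  forall x y : V, x \in vclosure mu Omega -> y \in vclosure mu Omega ->
    connect [rel u v | [set u; v]%SET \in tilde_edges mu Omega] x y.

(* Only the values on vclosure mu Omega are meaningful. *)
Definition vmeas (R : realType) (V : finType) (mu : V -> V -> R)
    (Omega : {set V}) (x : V) : R :=
  if x \in Omega then \sum_(y | 0 < mu x y) mu x y
  else \sum_(y in Omega | 0 < mu x y) mu x y.

Definition vmeas_set (R : realType) (V : finType) (mu : V -> V -> R)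
    (Omega A : {set V}) : R :=
  \sum_(x in A) vmeas mu Omega x.

Definition tilde_cut (R : realType) (V : finType) (mu : V -> V -> R)
    (Omega A : {set V}) : {set {set V}} :=
  (edges mu A (~: A) :&: tilde_edges mu Omega)%SET.

(* The infimum is taken in the extended reals, where ereal_inf set0 = +oo. *)
Definition escobar_cheeger (R : realType) (V : finType) (mu : V -> V -> R)
    (Omega : {set V}) : \bar R :=
  let D := vbdry mu Omega in
  ereal_inf [set (edge_weight mu (tilde_cut mu Omega A) /
                  vmeas_set mu Omega (A :&: D)%SET)%:E | A in
    [set A : {set V} | [/\ A \subset vclosure mu Omega,
       0 < vmeas_set mu Omega (A :&: D)%SET &
       vmeas_set mu Omega (A :&: D)%SET <= 2^-1 * vmeas_set mu Omega D]]]%classic.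

(* Functions on vclosure mu Omega are represented by functions on V: neither
   quantity below depends on the values of f outside vclosure mu Omega. *)
Definition tilde_variation (R : realType) (V : finType) (mu : V -> V -> R)
    (Omega : {set V}) (f : V -> R) : R :=
  \sum_(e in tilde_edges mu Omega)
     edge_val (fun x y => mu x y * `|f x - f y|) e.

Definition bdry_deviation (R : realType) (V : finType) (mu : V -> V -> R)
    (Omega : {set V}) (f : V -> R) : R :=
  inf [set \sum_(x in vbdry mu Omega) vmeas mu Omega x * `|f x - a|
      | a in [set: R]]%classic.

(* Main.v *)
(** A discrete coarea argument.  Indicator functions of admissible sets give
    one inequality: the total variation of 1_A is the weight of its cut, and
    its deviation on the boundary is m(A ∩ δΩ) because 0 is a median.
    Conversely, let a be a median of f on δΩ.  The total variation of f is the
    sum of those of (f - a)^+ and (f - a)^-, and every subset of {f > a} or of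
    {f < a} has at most half of the boundary measure.  Peeling off the
    superlevel sets of these two functions one value at a time bounds their
    total variation below by the Cheeger constant times their integral over
    δΩ. *)

Require Import Defs.
From HB Require Import structures.
From mathcomp Require Import all_boot all_order all_algebra.
From mathcomp Require Import all_classical all_reals ereal.
From mathcomp Require Import lra.
Set Implicit Arguments.
Unset Strict Implicit.
Unset Printing Implicit Defensive.
Import Order.TTheory GRing.Theory Num.Theory.
Local Open Scope ring_scope.

(** * Measures, total variation and indicator functions *)

Definition indic_set (R : realType) (V : finType) (A : {set V}) (x : V) : R :=
  (x \in A)%:R.
Arguments indic_set R {V} A x.

Lemma vmeas_ge0 (R : realType) (V : finType) (mu : V -> V -> R)
    (Omega : {set V}) (x : V) :
  (forall x y, 0 <= mu x y) -> 0 <= vmeas mu Omega x.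
Proof. by move=> mu_ge0; rewrite /vmeas; case: ifP => _; apply: sumr_ge0. Qed.

Lemma le_vmeas_set (R : realType) (V : finType) (mu : V -> V -> R)
    (Omega A B : {set V}) :
  (forall x y, 0 <= mu x y) -> A \subset B ->
  vmeas_set mu Omega A <= vmeas_set mu Omega B.
Proof.
move=> mu_ge0 /fintype.subsetP sAB; rewrite /vmeas_set big_mkcond.
rewrite [leRHS]big_mkcond /=.
apply: ler_sum => x _; case: ifP => [/sAB -> //|_].
by case: ifP => // _; apply: vmeas_ge0.
Qed.

Lemma vmeas_set_indic (R : realType) (V : finType) (mu : V -> V -> R)
    (Omega A D : {set V}) :
  vmeas_set mu Omega (A :&: D)%SET =
  \sum_(x in D) vmeas mu Omega x * indic_set R A x.
Proof.
rewrite /vmeas_set big_mkcond [RHS]big_mkcond /=; apply: eq_bigr => x _.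
rewrite inE /indic_set; case: (x \in A); case: (x \in D) => //=.
  by rewrite mulr1.
by rewrite mulr0.
Qed.

Lemma edge_val_ge0 (R : realType) (V : finType) (F : V -> V -> R)
    (e : {set V}) : (forall x y, 0 <= F x y) -> 0 <= edge_val F e.
Proof. by move=> F_ge0; rewrite /edge_val; case: pickP. Qed.

Lemma tilde_variation_ge0 (R : realType) (V : finType) (mu : V -> V -> R)
    (Omega : {set V}) (f : V -> R) :
  (forall x y, 0 <= mu x y) -> 0 <= tilde_variation mu Omega f.
Proof.
move=> mu_ge0; apply: sumr_ge0 => e _; apply: edge_val_ge0 => x y.
exact: mulr_ge0.
Qed.

(** Serves two decompositions: removal of one level of height [t], and, with [t = 1], the splitting
    into positive and negative parts. *)
Lemma tilde_variationD (R : realType) (V : finType) (mu : V -> V -> R)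
    (Omega : {set V}) (f g h : V -> R) (t : R) :
  (forall x y, `|f x - f y| = `|g x - g y| + t * `|h x - h y|) ->
  tilde_variation mu Omega f =
  tilde_variation mu Omega g + t * tilde_variation mu Omega h.
Proof.
move=> fgh; rewrite /tilde_variation mulr_sumr -big_split /=.
apply: eq_bigr => e _; rewrite /edge_val; case: pickP => [p _|_].
  by rewrite fgh mulrDr mulrCA.
by rewrite mulr0 addr0.
Qed.

Lemma tilde_edge_val (R : realType) (V : finType) (mu : V -> V -> R)
    (Omega : {set V}) (f : V -> R) (x y : V) :
  (forall x y, mu x y = mu y x) ->
  edge_val (fun x y => mu x y * `|f x - f y|) [set x; y]%SET =
  mu x y * `|f x - f y|.
Proof. by move=> mu_sym; rewrite edge_valE // => u v; rewrite mu_sym distrC. Qed.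

Lemma eq_tilde_variation (R : realType) (V : finType) (mu : V -> V -> R)
    (Omega : {set V}) (f g : V -> R) :
  (forall x y, mu x y = mu y x) -> {in vclosure mu Omega, f =1 g} ->
  tilde_variation mu Omega f = tilde_variation mu Omega g.
Proof.
move=> mu_sym fg; apply: eq_bigr => e /imset2P[x y xO].
rewrite inE => /andP[yO _] ->; rewrite !tilde_edge_val //.
by rewrite !fg // inE xO.
Qed.

Lemma tilde_variation_indic (R : realType) (V : finType) (mu : V -> V -> R)
    (Omega A : {set V}) :
  (forall x y, mu x y = mu y x) ->
  tilde_variation mu Omega (indic_set R A) =
  edge_weight mu (tilde_cut mu Omega A).
Proof.
move=> mu_sym; rewrite /tilde_variation /edge_weight big_mkcond.
rewrite [RHS]big_mkcond /=.
apply: eq_bigr => e _; rewrite /tilde_cut inE andbC.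
case: ifPn => //= /imset2P[x y xO]; rewrite inE => /andP[yO muxy] ->.
rewrite tilde_edge_val // edge_valE //.
(* An edge of the graph contributes exactly when [A] separates its ends, in whichever order they are
   listed. *)
suff -> : ([set x; y]%SET \in edges mu A (~: A)%SET) = ((x \in A) != (y \in A)).
  rewrite /indic_set; case: (x \in A); case: (y \in A) => /=;
    by rewrite ?subrr ?subr0 ?sub0r ?normrN ?normr0 ?normr1 ?mulr0 ?mulr1.
apply/imset2P/idP => [[u v uA]|].
  rewrite !inE => /andP[vA _] exy; apply/eqP => xAyA.
  have : u \in [set x; y]%SET by rewrite exy !inE eqxx.
  have : v \in [set x; y]%SET by rewrite exy !inE eqxx orbT.
  rewrite !inE => /orP[]/eqP vE /orP[]/eqP uE; move: uA vA; rewrite vE uE;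
    by rewrite ?xAyA => ->.
case: (boolP (x \in A)) => xA; case: (boolP (y \in A)) => yA // _.
  by exists x y; rewrite ?inE ?yA.
by exists y x; rewrite ?inE ?xA 1?mu_sym // finset.setUC.
Qed.

(* Induction on the support of g: with t its smallest positive value, subtract
   t from g on {g > 0}. *)
Lemma coarea_bound (R : realType) (V : finType) (mu : V -> V -> R)
    (Omega D : {set V}) (c : R) (g : V -> R) :
  (forall x y, 0 <= mu x y) -> (forall x, 0 <= g x) ->
  (forall A : {set V}, {in A, forall x, 0 < g x} ->
     c * vmeas_set mu Omega (A :&: D)%SET <=
     tilde_variation mu Omega (indic_set R A)) ->
  c * \sum_(x in D) vmeas mu Omega x * g x <= tilde_variation mu Omega g.
Proof.
move=> mu_ge0; have [n] := ubnP #|[set x | (0 < g x)%R]%SET|.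
elim: n g => // n IHn g ltn g_ge0 gA; set A := [set x | 0 < g x]%SET in ltn.
have [A0|/set0Pn[x0 x0A]] := eqVneq A finset.set0.
  rewrite big1 ?mulr0 ?tilde_variation_ge0 // => x _.
  suff -> : g x = 0 by rewrite mulr0.
  apply/le_anti; rewrite g_ge0 andbT leNgt.
  by have : x \notin A by [rewrite A0 inE]; rewrite inE.
pose y := [arg min_(x < x0 in A) g x]%O.
have [yA ymin] : y \in A /\ forall x, x \in A -> g y <= g x.
  by rewrite /y; case: arg_minP.
have y_gt0 : 0 < g y by move: yA; rewrite inE.
pose h x := g x - g y * indic_set R A x.
have hE x : h x = if x \in A then g x - g y else 0.
  rewrite /h /indic_set; case: ifPn => xA; rewrite ?mulr1 // mulr0 subr0.
  by apply/le_anti; rewrite g_ge0 andbT leNgt; rewrite inE in xA.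
have h_ge0 x : 0 <= h x by rewrite hE; case: ifP => // /ymin; rewrite subr_ge0.
have hg x : 0 < h x -> 0 < g x.
  by rewrite hE; case: ifP; rewrite ?ltxx // inE.
have lth : (#|[set x | (0 < h x)%R]%SET| < n)%N.
  rewrite ltnS in ltn; apply: leq_trans ltn; apply: proper_card; apply/properP; split.
    by apply/fintype.subsetP => x; rewrite !inE => /hg.
  by exists y; rewrite // inE hE yA subrr ltxx.
have hA (B : {set V}) : {in B, forall x, 0 < h x} ->
    c * vmeas_set mu Omega (B :&: D)%SET <=
    tilde_variation mu Omega (indic_set R B).
  by move=> Bh; apply: gA => x /Bh /hg.
(* Since [h] is nonnegative on [A] and zero off it, the increments of [h] and of the indicator of
   [A] never have opposite signs, so their absolute values add. *)
have -> : tilde_variation mu Omega g = tilde_variation mu Omega h +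
    g y * tilde_variation mu Omega (indic_set R A).
  apply: tilde_variationD => u v.
  have gE w : g w = h w + g y * indic_set R A w by rewrite /h subrK.
  have iE w : indic_set R A w = if w \in A then 1 else 0.
    by rewrite /indic_set; case: (w \in A).
  rewrite (gE u) (gE v); have := h_ge0 u; have := h_ge0 v; rewrite !hE !iE.
  case: ifP => _; case: ifP => _; rewrite ?mulr1 ?mulr0 => hu hv.
  - by rewrite subrr normr0 mulr0 addr0; congr (`| _ |); lra.
  - by rewrite !add0r !normrN normr1 !ger0_norm; lra.
  - by rewrite !addr0 !subr0 normr1 !ger0_norm; lra.
  - by rewrite addr0 subrr normr0 mulr0 addr0.
have -> : \sum_(x in D) vmeas mu Omega x * g x =
    \sum_(x in D) vmeas mu Omega x * h x + g y * vmeas_set mu Omega (A :&: D)%SET.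
  rewrite vmeas_set_indic mulr_sumr -big_split /=; apply: eq_bigr => x _.
  by rewrite mulrCA -mulrDr /h subrK.
rewrite mulrDr mulrCA lerD ?IHn // ler_pM2l //; apply: gA => x.
by rewrite inE.
Qed.

(** * Medians and the boundary deviation *)

(** The median is the largest value of [f] on [D] whose strict sublevel set carries at most half of
    the mass. *)
Lemma exists_median (R : realType) (V : finType) (mu : V -> V -> R)
    (Omega D : {set V}) (f : V -> R) :
  (forall x y, 0 <= mu x y) ->
  exists a : R,
    vmeas_set mu Omega ([set x | f x < a] :&: D)%SET <=
      2^-1 * vmeas_set mu Omega D /\
    vmeas_set mu Omega ([set x | a < f x] :&: D)%SET <=
      2^-1 * vmeas_set mu Omega D.
Proof.
move=> mu_ge0; set M := vmeas_set mu Omega D.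
have M_ge0 : 0 <= M by apply: sumr_ge0 => x _; apply: vmeas_ge0.
have m_set0 : vmeas_set mu Omega finset.set0 <= 2^-1 * M.
  by rewrite /vmeas_set big_set0 mulr_ge0 // invr_ge0.
have [D0|/set0Pn[d dD]] := eqVneq D finset.set0.
  by exists 0; rewrite D0 !finset.setI0.
pose low x := vmeas_set mu Omega ([set z | f z < f x] :&: D)%SET <= 2^-1 * M.
pose x0 := [arg min_(x < d in D) f x]%O.
(* The minimum of [f] on [D] has an empty strict sublevel set, so the maximum below is over a
   nonempty set. *)
have x0P : (x0 \in D) && low x0.
  rewrite /x0; case: arg_minP => // x xD xmin; rewrite xD /= /low.
  suff -> : ([set z | (f z < f x)%R] :&: D)%SET = finset.set0 by [].
  apply/finset.setP => z; rewrite !inE; apply/negP => /andP[+ zD].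
  by rewrite ltNge xmin.
pose x1 := [arg max_(x > x0 | (x \in D) && low x) f x]%O.
have [/andP[x1D x1low] x1max] : ((x1 \in D) && low x1) /\
    forall x, (x \in D) && low x -> f x <= f x1.
  by rewrite /x1; case: arg_maxP.
exists (f x1); split=> //.
have [->//|/set0Pn[b0 b0P]] :=
  eqVneq ([set x | (f x1 < f x)%R] :&: D)%SET finset.set0.
set U := ([set x | (f x1 < f x)%R] :&: D)%SET in b0P *.
pose b := [arg min_(x < b0 in U) f x]%O.
have [bU bmin] : b \in U /\ forall x, x \in U -> f b <= f x.
  by rewrite /b; case: arg_minP.
move: (bU); rewrite !inE => /andP[x1b bD].
have : ~~ low b by apply: contraL x1b => blow; rewrite -leNgt x1max ?bD.
rewrite /low -ltNge; set L := (_ :&: D)%SET => ltL.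
(* No value of [f] on [D] lies strictly between [f x1] and [f b], so [L] and [U] partition [D]; as
   [L] has more than half of the mass, [U] has less. *)
suff ME : M = vmeas_set mu Omega L + vmeas_set mu Omega U by lra.
rewrite /M /vmeas_set (big_setID L) /=; congr (_ + _); apply: eq_bigl => x.
  by rewrite !inE andbCA andbb.
rewrite !inE; case: (boolP (x \in D)) => xD; rewrite ?andbF ?andbT //= -leNgt.
apply/idP/idP => [|x1x]; first exact: lt_le_trans.
by apply: bmin; rewrite !inE x1x.
Qed.

Lemma bdry_deviation_le (R : realType) (V : finType) (mu : V -> V -> R)
    (Omega : {set V}) (f : V -> R) (a : R) :
  (forall x y, 0 <= mu x y) ->
  bdry_deviation mu Omega f <=
  \sum_(x in vbdry mu Omega) vmeas mu Omega x * `|f x - a|.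
Proof.
move=> mu_ge0; apply: ge_inf; last by exists a.
exists 0 => _ [b _ <-]; apply: sumr_ge0 => x _.
by rewrite mulr_ge0 // vmeas_ge0.
Qed.

Lemma le_bdry_deviation (R : realType) (V : finType) (mu : V -> V -> R)
    (Omega : {set V}) (f : V -> R) (c : R) :
  (forall a, c <= \sum_(x in vbdry mu Omega) vmeas mu Omega x * `|f x - a|) ->
  c <= bdry_deviation mu Omega f.
Proof.
move=> c_le; apply: lb_le_inf => [|_ [a _ <-]]; last exact: c_le.
by exists (\sum_(x in vbdry mu Omega) vmeas mu Omega x * `|f x - 0|), 0.
Qed.

Lemma bdry_deviation_ge0 (R : realType) (V : finType) (mu : V -> V -> R)
    (Omega : {set V}) (f : V -> R) :
  (forall x y, 0 <= mu x y) -> 0 <= bdry_deviation mu Omega f.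
Proof.
move=> mu_ge0; apply: le_bdry_deviation => a; apply: sumr_ge0 => x _.
by rewrite mulr_ge0 // vmeas_ge0.
Qed.

Lemma bdry_deviation_indic (R : realType) (V : finType) (mu : V -> V -> R)
    (Omega A : {set V}) (D := vbdry mu Omega) :
  (forall x y, 0 <= mu x y) ->
  vmeas_set mu Omega (A :&: D)%SET <= 2^-1 * vmeas_set mu Omega D ->
  bdry_deviation mu Omega (indic_set R A) = vmeas_set mu Omega (A :&: D)%SET.
Proof.
move=> mu_ge0 half; apply/le_anti/andP; split.
  apply: le_trans (bdry_deviation_le _ _ 0 mu_ge0) _.
  rewrite vmeas_set_indic; apply: ler_sum => x _.
  by rewrite subr0 /indic_set normr_nat.
apply: le_bdry_deviation => a.
set m := vmeas_set mu Omega (A :&: D)%SET in half *.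
have m_ge0 : 0 <= m by apply: sumr_ge0 => x _; apply: vmeas_ge0.
(* Boundary points in [A] pay [|1 - a|], the others [|a|]. The latter weigh at least [m], and
   [|1 - a| + |a|] is at least 1. *)
have -> : \sum_(x in D) vmeas mu Omega x * `|indic_set R A x - a| =
    m * `|1 - a| + (vmeas_set mu Omega D - m) * `|a|.
  rewrite /m vmeas_set_indic /vmeas_set -sumrB !mulr_suml -big_split /=.
  apply: eq_bigr => x _; rewrite /indic_set; case: (x \in A) => /=.
    by rewrite mulr1 subrr mul0r addr0.
  by rewrite mulr0 mul0r subr0 !add0r normrN.
apply: (@le_trans _ _ (m * `|1 - a| + m * `|a|)); last first.
  by rewrite lerD2l ler_wpM2r //; lra.
rewrite -mulrDr ler_peMr //; apply: le_trans (ler_normD _ _).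
by rewrite subrK normr1.
Qed.

(** As the argument grows, its positive part about [a] grows and its negative part shrinks, so the
    two increments never cancel in their difference. *)
Lemma dist_max_min (R : realType) (a u v : R) :
  `|u - v| = `|Num.max (u - a) 0 - Num.max (v - a) 0| +
             1 * `|Num.max (a - u) 0 - Num.max (a - v) 0|.
Proof.
rewrite mul1r.
case: (leP (u - a) 0) => ?; case: (leP (v - a) 0) => ?;
  case: (leP (a - u) 0) => ?; case: (leP (a - v) 0) => ?; try lra;
  repeat match goal with
    |- context [`|?x|] => case: (ger0P x) => ?
  end; lra.
Qed.

(** * Comparison with the Cheeger constant *)

Lemma cheeger_le_variation (R : realType) (V : finType) (mu : V -> V -> R)
    (Omega : {set V}) (D := vbdry mu Omega) (c : R) (f : V -> R) :
  (forall x y, 0 <= mu x y) -> 0 <= c ->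
  (forall A : {set V},
     vmeas_set mu Omega (A :&: D)%SET <= 2^-1 * vmeas_set mu Omega D ->
     c * vmeas_set mu Omega (A :&: D)%SET <=
     tilde_variation mu Omega (indic_set R A)) ->
  c * bdry_deviation mu Omega f <= tilde_variation mu Omega f.
Proof.
move=> mu_ge0 c_ge0 cA; have [a [lo hi]] := exists_median Omega D f mu_ge0.
pose p x := Num.max (f x - a) 0; pose q x := Num.max (a - f x) 0.
rewrite (@tilde_variationD _ _ _ _ f p q 1); last first.
  by move=> u v; apply: dist_max_min.
(* The parts satisfy [p + q = |f - a|], whose weighted boundary sum bounds the deviation from
   above. *)
rewrite mul1r; apply: (@le_trans _ _ (c * \sum_(x in D) vmeas mu Omega x * p x
    + c * \sum_(x in D) vmeas mu Omega x * q x)).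
  rewrite -mulrDr ler_wpM2l // -big_split /=.
  apply: le_trans (bdry_deviation_le _ _ a mu_ge0) _.
  apply: ler_sum => x _; rewrite -mulrDr ler_wpM2l ?vmeas_ge0 // /p /q.
  by case: (leP (f x - a) 0) => ?; case: (leP (a - f x) 0) => ?;
    case: (ger0P (f x - a)) => ?; lra.
apply: lerD; apply: coarea_bound => // [x|A Apos].
- by rewrite /p le_max lexx orbT.
- apply: cA; apply: le_trans hi; apply: le_vmeas_set => //; apply: finset.setSI.
  by apply/fintype.subsetP => x /Apos; rewrite /p lt_max ltxx orbF subr_gt0 inE.
- by rewrite /q le_max lexx orbT.
- apply: cA; apply: le_trans lo; apply: le_vmeas_set => //; apply: finset.setSI.
  by apply/fintype.subsetP => x /Apos; rewrite /q lt_max ltxx orbF subr_gt0 inE.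
Qed.

(** Passes from admissible sets to arbitrary ones: intersecting with the closure changes neither
    side, and a set of zero boundary mass satisfies the bound trivially. *)
Lemma escobar_cheeger_indic (R : realType) (V : finType) (mu : V -> V -> R)
    (Omega : {set V}) (D := vbdry mu Omega) (c : R) (A : {set V}) :
  (forall x y, 0 <= mu x y) -> (forall x y, mu x y = mu y x) ->
  (c%:E <= escobar_cheeger mu Omega)%E ->
  vmeas_set mu Omega (A :&: D)%SET <= 2^-1 * vmeas_set mu Omega D ->
  c * vmeas_set mu Omega (A :&: D)%SET <=
  tilde_variation mu Omega (indic_set R A).
Proof.
move=> mu_ge0 mu_sym c_le half; set B := (A :&: vclosure mu Omega)%SET.
have BD : (B :&: D = A :&: D)%SET.
  apply/finset.setP => x; rewrite !inE; case: (x \in A) => //=.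
  by case: (x \in Omega) => //=; rewrite andbb.
rewrite (@eq_tilde_variation _ _ _ _ _ (indic_set R B)) //; last first.
  by move=> x xO; rewrite /indic_set inE xO andbT.
rewrite tilde_variation_indic // -BD in half *.
have [m_gt0|m_le0] := ltP 0 (vmeas_set mu Omega (B :&: D)%SET).
  rewrite -ler_pdivlMr // -lee_fin; apply: le_trans c_le _.
  by apply: ereal_inf_lbound; exists B; split=> //; apply: finset.subsetIr.
have -> : vmeas_set mu Omega (B :&: D)%SET = 0.
  by apply/le_anti; rewrite m_le0 sumr_ge0 // => x _; apply: vmeas_ge0.
rewrite mulr0; apply: sumr_ge0 => e _; exact: edge_val_ge0.
Qed.

Theorem theorem1p1 (R : realType) (V : finType) (mu : V -> V -> R)
    (mu_ge0 : forall x y, 0 <= mu x y)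
    (mu_sym : forall x y, mu x y = mu y x)
    (Omega : {set V})
    (m_gt0 : forall x, x \in vclosure mu Omega -> 0 < vmeas mu Omega x)
    (Omega_conn : tilde_connected mu Omega) :
  escobar_cheeger mu Omega =
  ereal_inf [set (tilde_variation mu Omega f / bdry_deviation mu Omega f)%:E
    | f in [set f : V -> R | bdry_deviation mu Omega f != 0]]%classic.
Proof.
apply/le_anti/andP; split; apply: le_ereal_inf_tmp => y /=.
  move=> [f /= dev_neq0 <- {y}].
  have dev_gt0 : 0 < bdry_deviation mu Omega f.
    by rewrite lt_def dev_neq0 bdry_deviation_ge0.
  set r := _ / _.
  have r_ge0 : 0 <= r by rewrite divr_ge0 ?tilde_variation_ge0 ?ltW.
  (* The Cheeger constant may be infinite, so it is tested through its real lower bounds [c];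
     negative ones are harmless because [r] is nonnegative. *)
  have le_r c : (c%:E <= escobar_cheeger mu Omega)%E -> c <= r.
    have [c_ge0 c_le|c_lt0 _] := leP 0 c; last exact: le_trans (ltW c_lt0) _.
    rewrite ler_pdivlMr //; apply: cheeger_le_variation => // A.
    exact: escobar_cheeger_indic.
  case: (escobar_cheeger mu Omega) le_r => [c||] le_r; last exact: leNye.
    by rewrite lee_fin le_r.
  (* An infinite Cheeger constant would give [r + 1 <= r]. *)
  by have := le_r (r + 1) (leey _); rewrite gerDl ler10.
move=> [A [_ mA_gt0 half] <- {y}]; apply: ereal_inf_lbound.
exists (indic_set R A); first by rewrite /= bdry_deviation_indic // gt_eqF.
by rewrite bdry_deviation_indic // tilde_variation_indic.
Qed.
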